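(* Let $m\ge 2$ and let $Y_1,\dots,Y_m\in\mathbb{R}^{2n\times n}$ be frames, i.e. $Y_k^T\mathcal{J}Y_k=0$ and $\operatorname{rank}Y_k=n$ for all $k$. Put $w_{i,j}:=Y_i^T\mathcal{J}Y_j$ and let $S_{1,2,\dots,m}$ be the $mn\times mn$ symmetric matrix with $n\times n$ blocks: the $(i,i)$ block is $0$, the $(i,j)$ block is $w_{i,j}$ for $i<j$, and the $(j,i)$ block is $w_{i,j}^T$ for $i<j$. Then $$\mu_c^{\pm}(Y_1,Y_2,\dots,Y_m)=i_{\mp}(S_{1,2,\dots,m})=\operatorname{ind}(\pm S_{1,2,\dots,m}),$$ that is, $\mu_c^{+}(Y_1,\dots,Y_m)=i_-(S_{1,\dots,m})=\operatorname{ind}(S_{1,\dots,m})$ and $\mu_c^{-}(Y_1,\dots,Y_m)=i_+(S_{1,\dots,m})=\operatorname{ind}(-S_{1,\dots,m})$.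
   Context: $\mathcal{J}=\begin{pmatrix}0&I\\-I&0\end{pmatrix}\in\mathbb{R}^{2n\times 2n}$ and $w(Y,\hat Y)=Y^T\mathcal{J}\hat Y$. For a real symmetric matrix $A$, $i_+(A)$ and $i_-(A)$ are the numbers of positive and negative eigenvalues counted with multiplicity, and $\operatorname{ind}A=i_-(A)$. $A^{\dagger}$ is the Moore–Penrose pseudoinverse. A frame is a real $2n\times n$ matrix $Y$ with $w(Y,Y)=0$ and $\operatorname{rank}Y=n$. For frames $Y=\binom{X}{U}$, $\hat Y=\binom{\hat X}{\hat U}$ ($n\times n$ blocks) put $\mathcal M=(I-X^{\dagger}X)\,w(Y,\hat Y)$, $\mathcal T=I-\mathcal M^{\dagger}\mathcal M$, $\mathcal P=\mathcal T\,w(Y,\hat Y)^T X^{\dagger}\hat X\,\mathcal T$ (this $\mathcal P$ is symmetric). The comparative index and dual comparative index are $\mu(Y,\hat Y)=\operatorname{rank}\mathcal M+\operatorname{ind}\mathcal P$ and $\mu^*(Y,\hat Y)=\operatorname{rank}\mathcal M+\operatorname{ind}(-\mathcal P)$. For frames $Y_1,\dots,Y_m$, $m\ge2$, the cyclic sums (of the first kind) are $\mu_c^-(Y_1,\dots,Y_m)=\sum_{k=1}^{m-1}\mu(Y_k,Y_{k+1})+\mu(Y_m,Y_1)$ and $\mu_c^+(Y_1,\dots,Y_m)=\sum_{k=1}^{m-1}\mu^*(Y_k,Y_{k+1})+\mu^*(Y_m,Y_1)$. *)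

(* Defs.v *)
From HB Require Import structures.
From mathcomp Require Import all_boot all_order all_algebra.
From mathcomp Require Import polyrcf.

Set Implicit Arguments.
Unset Strict Implicit.
Unset Printing Implicit Defensive.

Import Order.TTheory GRing.Theory Num.Theory.
Local Open Scope ring_scope.

Section MoorePenrose.
Variable R : realFieldType.

(* The four Penrose equations; over a real field the adjoint is the transpose. *)
Definition penrose m n (A : 'M[R]_(m, n)) (B : 'M[R]_(n, m)) : bool :=
  [&& A *m B *m A == A, B *m A *m B == B,
      (A *m B)^T == A *m B & (B *m A)^T == B *m A].

Lemma row_free_gram_unit m n (A : 'M[R]_(m, n)) :
  row_free A -> A *m A^T \in unitmx.
Proof.
move=> fA; rewrite -row_free_unit -kermx_eq0; apply/rowV0P => v /sub_kermxP vAA.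
have vA0 : v *m A = 0.
  have /eqP : \tr ((v *m A) *m (v *m A)^T) = 0.
    by rewrite trmx_mul !mulmxA -(mulmxA v) vAA mul0mx mxtrace0.
  rewrite /mxtrace big_ord1 mxE psumr_eq0; last first.
    by move=> j _; rewrite [_^T _ _]mxE -expr2 sqr_ge0.
  move/allP=> v0; apply/rowP=> j; rewrite [RHS]mxE; apply/eqP.
  by have := v0 j (mem_index_enum _); rewrite [_^T _ _]mxE mulf_eq0 orbb.
by apply: (row_free_inj fA); rewrite vA0 mul0mx.
Qed.

Lemma penrose_exists m n (A : 'M[R]_(m, n)) : exists B, penrose A B.
Proof.
have [r [C [F [uF uC AE]]]] : exists r (C : 'M[R]_(m, r)) (F : 'M[R]_(r, n)),
  [/\ F *m F^T \in unitmx, C^T *m C \in unitmx & A = C *m F].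
  exists (\rank A), (col_base A), (row_base A); split; last by rewrite mulmx_base.
    by apply: row_free_gram_unit; exact: row_base_free.
  rewrite -{2}(trmxK (col_base A)); apply: row_free_gram_unit.
  by rewrite /row_free mxrank_tr; exact: col_base_full.
pose G := invmx (F *m F^T); pose H := invmx (C^T *m C).
have GT : G^T = G by rewrite /G trmx_inv trmx_mul trmxK.
have HT : H^T = H by rewrite /H trmx_inv trmx_mul trmxK.
pose B := F^T *m G *m H *m C^T.
have AB : A *m B = C *m H *m C^T.
  by rewrite AE /B !mulmxA -(mulmxA C F) -(mulmxA C _ G) mulmxV // mulmx1.
have BA : B *m A = F^T *m G *m F.
  rewrite AE /B !mulmxA -(mulmxA _ C^T C) -(mulmxA _ H) mulVmx // mulmx1.
  by [].
exists B; apply/and4P; split; apply/eqP.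
- by rewrite AB AE !mulmxA -(mulmxA _ C^T C) -(mulmxA C H) mulVmx // mulmx1.
- by rewrite BA /B !mulmxA -(mulmxA _ F) -(mulmxA _ _ G) mulmxV // mulmx1.
- by rewrite AB !trmx_mul trmxK HT mulmxA.
- by rewrite BA !trmx_mul trmxK GT mulmxA.
Qed.

Lemma penrose_uniq m n (A : 'M[R]_(m, n)) B1 B2 :
  penrose A B1 -> penrose A B2 -> B1 = B2.
Proof.
move=> /and4P[/eqP a1 /eqP b1 /eqP c1 /eqP d1].
move=> /and4P[/eqP a2 /eqP b2 /eqP c2 /eqP d2].
have eAB : A *m B1 = A *m B2.
  by rewrite -[LHS]c1 -{1}a2 -(mulmxA (A *m B2)) trmx_mul c1 c2 mulmxA a1.
have eBA : B1 *m A = B2 *m A.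
  by rewrite -[LHS]d1 -{1}a2 -!mulmxA mulmxA trmx_mul d1 d2 -!mulmxA (mulmxA A) a1.
by rewrite -b1 eBA -mulmxA eAB mulmxA b2.
Qed.

Definition mp_pinv m n (A : 'M[R]_(m, n)) : 'M[R]_(n, m) :=
  xchoose (penrose_exists A).

Lemma mp_pinvP m n (A : 'M[R]_(m, n)) : penrose A (mp_pinv A).
Proof. exact: xchooseP. Qed.

End MoorePenrose.

Section Inertia.
Variable R : rcfType.

(* rootsR lists the distinct real roots of the characteristic polynomial and
   mup is the multiplicity of a root; for a symmetric matrix, all eigenvalues
   are real and algebraic and geometric multiplicities agree. *)
Definition i_plus k (A : 'M[R]_k) : nat :=
  (\sum_(x <- rootsR (char_poly A) | (0 < x)%R) mup x (char_poly A))%N.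

Definition i_minus k (A : 'M[R]_k) : nat :=
  (\sum_(x <- rootsR (char_poly A) | (x < 0)%R) mup x (char_poly A))%N.

Definition ind k (A : 'M[R]_k) : nat := i_minus A.

End Inertia.

Section ComparativeIndex.
Variables (R : rcfType) (n : nat).
Implicit Types Y Z : 'M[R]_(n + n, n).

Definition Jmx : 'M[R]_(n + n) := block_mx 0 1%:M (- 1%:M) 0.

Definition wronskian Y Z : 'M[R]_n := Y^T *m Jmx *m Z.

Definition frame Y : Prop := wronskian Y Y = 0 /\ \rank Y = n.

Definition Mmx Y Z : 'M[R]_n :=
  (1%:M - mp_pinv (usubmx Y) *m usubmx Y) *m wronskian Y Z.

Definition Tmx Y Z : 'M[R]_n := 1%:M - mp_pinv (Mmx Y Z) *m Mmx Y Z.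

Definition Pmx Y Z : 'M[R]_n :=
  Tmx Y Z *m (wronskian Y Z)^T *m mp_pinv (usubmx Y) *m usubmx Z *m Tmx Y Z.

Definition comp_index Y Z : nat := (\rank (Mmx Y Z) + ind (Pmx Y Z))%N.

Definition dual_comp_index Y Z : nat := (\rank (Mmx Y Z) + ind (- Pmx Y Z))%N.

(* ordS k is k + 1 modulo m, so the last term pairs the last frame with the
   first one; see cyclic_sumE. *)
Definition cyclic_sum m (f : 'M[R]_(n + n, n) -> 'M[R]_(n + n, n) -> nat)
    (Y : 'I_m -> 'M[R]_(n + n, n)) : nat :=
  (\sum_(k < m) f (Y k) (Y (ordS k)))%N.

Lemma cyclic_sumE m f (Y : 'I_m.+1 -> 'M[R]_(n + n, n)) :
  cyclic_sum f Y =
  (\sum_(k < m) f (Y (widen_ord (leqnSn m) k)) (Y (lift ord0 k))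
   + f (Y ord_max) (Y ord0))%N.
Proof.
rewrite /cyclic_sum big_ord_recr /=; congr (_ + _)%N.
  apply: eq_bigr => k _; congr (f _ (Y _)); apply: val_inj => /=.
  by rewrite modn_small ?ltnS.
by congr (f _ (Y _)); apply: val_inj; rewrite /= modnn.
Qed.

Definition mu_c_minus m (Y : 'I_m -> 'M[R]_(n + n, n)) : nat :=
  cyclic_sum comp_index Y.

Definition mu_c_plus m (Y : 'I_m -> 'M[R]_(n + n, n)) : nat :=
  cyclic_sum dual_comp_index Y.

Definition Smx m (Y : 'I_m -> 'M[R]_(n + n, n)) :
    'M[R]_(\sum_(i < m) n, \sum_(j < m) n) :=
  \mxblock_(i < m, j < m)
    (if (i < j)%N then wronskian (Y i) (Y j)
     else if (j < i)%N then (wronskian (Y j) (Y i))^T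
     else 0).

End ComparativeIndex.

(* Main.v *)
Require Import Defs.
From mathcomp Require Import all_boot all_order all_algebra.
From mathcomp Require Import polyrcf complex spectral ring reals.

Set Implicit Arguments.
Unset Strict Implicit.
Unset Printing Implicit Defensive.

Import Order.TTheory GRing.Theory Num.Theory.
Local Open Scope ring_scope.

(* Finitely many frames have a common transversal Lagrangian subspace; moving it
   to the vertical one turns the frames into graphs of symmetric matrices Q_k, so
   that, up to congruence, w_ij = Q_j - Q_i.  In the variables u_k equal to the
   sum of the first k components minus half of the sum of all of them, the form
   of S is block diagonal with blocks proportional to -(Q_(k+1) - Q_k), indices
   taken cyclically; so i_-(S) is the sum of the g(k, k+1), where
   g(a, b) = i_-(-(Q_b - Q_a)).

   Let V be the vertical frame.  Eliminating the isotropic block of V from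
   S(Y, Z, V) gives i_-(S(Y, Z, V)) = rank X + mu*(Y, Z), X being the upper block
   of Y.  By the previous formula the left-hand side is
   g(Y, Z) + g(Z, V) + g(V, Y), and g(Y, V) + g(V, Y) = rank X.  In a cyclic sum
   of these relations all terms involving V cancel against the ranks.  Replacing
   S by -S gives the statement for mu. *)

(** * Orthogonal diagonalization of real symmetric matrices, and inertia as a count of diagonal
    entries *)

Section Spectral.
Variable R : rcfType.

(** Over the complex extension of [R] the matrix is Hermitian, so the spectral theorem supplies an
    eigenvector whose eigenvalue is real; being an eigenvalue does not depend on the field. *)
Lemma symmetric_eigenvalue n (A : 'M[R]_n.+1) : A^T = A ->
  exists a, eigenvalue A a.
Proof.
move=> As; pose AC := map_mx (real_complex R) A.
have AC_herm : AC \is hermsymmx.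
  apply: realsym_hermsym.
    by apply/is_hermitianmxP; rewrite expr0 scale1r map_mx_id // /AC map_trmx As.
  by apply/mxOverP => i j; rewrite mxE complex_real.
have /orthomx_spectralP ACE := hermitian_normalmx AC_herm.
have /mxOverP /(_ 0 0) /complex_realP[a aE] := hermitian_spectral_diag_real AC_herm.
exists a; rewrite -(eigenvalue_map (real_complex R)) -/AC.
have Pu := spectral_unit AC.
apply/eigenvalueP; exists (row 0 (spectralmx AC)).
  have PA : spectralmx AC *m AC = diag_mx (spectral_diag AC) *m spectralmx AC.
    by rewrite [X in _ *m X = _]ACE -mulmxA mulKVmx.
  by rewrite -row_mul PA row_mul row_diag_mx -scalemxAl -rowE aE.
apply/eqP => r0; have /row_freeP[Q PQ] : row_free (spectralmx AC).
  by rewrite row_free_unit.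
have /matrixP /(_ 0 0) : row 0 (spectralmx AC *m Q) = 0 by rewrite row_mul r0 mul0mx.
by rewrite PQ !mxE eqxx => /eqP; rewrite oner_eq0.
Qed.

Lemma rV_sqr_gt0 n (v : 'rV[R]_n) : v != 0 -> 0 < (v *m v^T) 0 0.
Proof.
move=> v0; rewrite lt_def mxE.
have ge0 i : (i \in index_enum 'I_n) -> true -> 0 <= v 0 i * v^T i 0.
  by move=> _ _; rewrite mxE -expr2 sqr_ge0.
rewrite big_seq sumr_ge0; last by move=> i /ge0; apply.
rewrite andbT -big_seq psumr_eq0; last by move=> i _; rewrite mxE -expr2 sqr_ge0.
apply: contraNN v0 => /allP v0; apply/eqP/rowP => j; rewrite [RHS]mxE; apply/eqP.
by have := v0 j (mem_index_enum _); rewrite mxE mulf_eq0 orbb.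
Qed.

(* Householder reflection in the hyperplane orthogonal to [v - e], which
   exchanges the unit vectors [e] and [v]. *)
Lemma orthogonal_first_row n (v : 'rV[R]_n.+1) : v *m v^T = 1%:M ->
  exists2 H : 'M[R]_n.+1, H *m H^T = 1%:M & row 0 H = v.
Proof.
move=> v1; pose e : 'rV[R]_n.+1 := delta_mx 0 0.
have [vE|ve] := eqVneq v e.
  by exists 1%:M; rewrite ?trmx1 ?mulmx1 // row1 vE.
pose u := v - e; have u0 : u != 0 by rewrite subr_eq0.
have uu := rV_sqr_gt0 u0; set c := (u *m u^T) 0 0 in uu.
have uuE : u *m u^T = c%:M by rewrite [LHS]mx11_scalar.
have evT : v *m e^T = e *m v^T.
  by apply: trmx_inj; rewrite trmx_mul trmxK [LHS]mx11_scalar [RHS]mx11_scalar !mxE;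
     congr (_ %:M); apply: eq_bigr => i _; rewrite !mxE mulrC.
have e1 : e *m e^T = 1%:M.
  by rewrite trmx_delta mul_delta_mx; apply/matrixP => i j; rewrite !ord1 !mxE.
(* As [e] and [v] have equal length, the squared length of [u] is -2 times its product with [e]; the
   reflection therefore sends [e] to [e + u = v]. *)
have cE : e *m u^T = (- c / 2)%:M.
  have : u *m u^T = - (2 *: (e *m u^T)).
    rewrite /u [(_ - _)^T]raddfB /= mulmxBl !mulmxBr v1 e1 evT.
    by rewrite -(opprB _ 1%:M) -opprD scaler_nat mulr2n.
  move=> h; apply: (@scalerI _ _ (- 2)); first by rewrite oppr_eq0 pnatr_eq0.
  rewrite scaleNr -h uuE scale_scalar_mx; congr (_ %:M).
  by field.
pose H : 'M[R]_n.+1 := 1%:M - (2 / c) *: (u^T *m u).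
have cN0 : c != 0 by rewrite gt_eqF.
have HT : H^T = H by rewrite /H [LHS]raddfB /= trmx1 linearZ /= trmx_mul trmxK.
exists H.
  have WW : (u^T *m u) *m (u^T *m u) = c *: (u^T *m u).
    by rewrite mulmxA -(mulmxA u^T) uuE mul_mx_scalar -scalemxAl.
  rewrite HT /H; move: (u^T *m u) WW => W WW.
  rewrite mulmxBl !mulmxBr !mul1mx mulmx1 -!scalemxAl -!scalemxAr WW !scalerA.
  rewrite -scalerBl -addrA -opprD -scalerDl.
  rewrite -[RHS]subr0; congr (_ - _); rewrite -[RHS](scale0r W).
  by congr (_ *: _); field.
rewrite rowE mulmxBr mulmx1 -scalemxAr mulmxA -/e cE mul_scalar_mx scalerA.
rewrite (_ : 2 / c * (- c / 2) = -1); last by field.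
by rewrite scaleN1r opprK addrC subrK.
Qed.

Definition orthodiag n (A : 'M[R]_n) :=
  exists H : 'M[R]_n, exists2 d : 'rV[R]_n,
    H *m H^T = 1%:M & H *m A *m H^T = diag_mx d.

(** Deflation: with a unit eigenvector as first row of an orthogonal [H], the first row of the
    conjugate is a multiple of the first basis vector, and symmetry splits off a 1 by 1 block. *)
Lemma orthodiag_step n : (forall A : 'M[R]_n, A^T = A -> orthodiag A) ->
  forall A : 'M[R]_(1 + n), A^T = A -> orthodiag A.
Proof.
move=> IHn A As.
have [a /eigenvalueP[v vA v0]] := symmetric_eigenvalue As.
have s0 := rV_sqr_gt0 v0; set s := (v *m v^T) 0 0 in s0.
pose v' := (Num.sqrt s)^-1 *: v.
have v1 : v' *m v'^T = 1%:M.
  rewrite linearZ /= -scalemxAl -scalemxAr scalerA [v *m _]mx11_scalar -/s.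
  rewrite scale_scalar_mx -invfM -expr2 sqr_sqrtr ?ltW // mulVf // gt_eqF //.
have v'A : v' *m A = a *: v' by rewrite -scalemxAl vA !scalerA mulrC.
have [H HH Hv] : exists2 H : 'M[R]_(1 + n), H *m H^T = 1%:M & row 0 H = v'.
  exact: orthogonal_first_row.
have [B BH] : {B : 'M_(1 + n) | B = H *m A *m H^T} by eexists.
have Bs : B^T = B by rewrite BH !trmx_mul trmxK As mulmxA.
have rB : row 0 B = a *: delta_mx 0 0.
  rewrite BH -mulmxA row_mul Hv mulmxA v'A -scalemxAl; congr (_ *: _).
  by rewrite -Hv -row_mul HH row1.
have rB0 j : B 0 j = a * (j == 0)%:R by have /rowP /(_ j) := rB; rewrite !mxE.
have ur0 : ursubmx B = 0.
  apply/matrixP => i j; rewrite !ord1 !mxE -[RHS](mulr0 a).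
  by rewrite -[RHS](rB0 (rshift 1 j)); congr (B _ _); apply: val_inj.
have BE : B = block_mx a%:M 0 0 (drsubmx B).
  have dl0 : dlsubmx B = 0 by rewrite -Bs -trmx_ursub ur0 trmx0.
  rewrite -[LHS]submxK ur0 dl0; congr block_mx.
  apply/matrixP => i j; rewrite !ord1 !mxE mulr1n -[RHS]mulr1.
  by rewrite -[RHS](rB0 (lshift n 0)); congr (B _ _); apply: val_inj.
have [|G [d GG Gd]] := IHn (drsubmx B); first by rewrite trmx_drsub Bs.
pose K : 'M_(1 + n) := block_mx 1%:M 0 0 G.
have KT : K^T = block_mx 1%:M 0 0 G^T by rewrite tr_block_mx trmx1 !trmx0.
exists (K *m H), (row_mx a%:M d).
  rewrite trmx_mul mulmxA -(mulmxA K) HH mulmx1 KT mulmx_block.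
  by rewrite !mul0mx !mulmx0 mulmx1 !addr0 add0r GG [RHS]scalar_mx_block.
rewrite trmx_mul !mulmxA -(mulmxA K) -(mulmxA K) -BH BE KT !mulmx_block.
rewrite !mul0mx !mulmx0 !mulmx1 !mul1mx !addr0 !add0r mul0mx Gd.
by rewrite diag_mx_row; congr block_mx; apply/matrixP => i j; rewrite !ord1 !mxE eqxx.
Qed.

Theorem symmetric_orthodiag n (A : 'M[R]_n) : A^T = A -> orthodiag A.
Proof.
elim: n A => [|n IHn] A As; last exact: (orthodiag_step IHn).
by exists 1%:M, 0; rewrite ?trmx1 ?mulmx1 //; apply/matrixP => -[].
Qed.

Lemma char_poly_orthogonal_conj n (H A : 'M[R]_n) : H *m H^T = 1%:M ->
  char_poly (H *m A *m H^T) = char_poly A.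
Proof.
move=> HH; have HH' := mulmx1C HH; rewrite /char_poly /char_poly_mx !map_mxM.
set h := map_mx _ H; set h' := map_mx _ H^T; set a := map_mx _ A.
have hh : h *m h' = 1%:M by rewrite -map_mxM HH map_mx1.
have -> : 'X%:M - h *m a *m h' = h *m ('X%:M - a) *m h'.
  by rewrite mulmxBr mulmxBl mul_mx_scalar -scalemxAl hh scalemx1.
by rewrite !det_mulmx mulrAC -det_mulmx hh det1 mul1r.
Qed.

Lemma sum_count_mem (T : eqType) (P : pred T) (r s : seq T) :
  uniq r -> {subset s <= r} ->
  (\sum_(x <- r | P x) count_mem x s)%N = count P s.
Proof.
move=> Ur; elim: s => [|y s IHs] sr /=; first by rewrite big1.
rewrite big_split /= IHs; last by move=> x xs; rewrite sr // inE xs orbT.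
congr addn; rewrite big_mkcond (bigD1_seq y) ?sr ?mem_head //= eqxx.
rewrite big1 ?addn0; first by case: (P y).
by move=> x xy; rewrite eq_sym (negPf xy) if_same.
Qed.

Lemma sum_rootsR_mup (P : pred R) (s : seq R) (p := \prod_(y <- s) ('X - y%:P)) :
  (\sum_(x <- rootsR p | P x) mup x p)%N = count P s.
Proof.
have p0 : p != 0 by rewrite monic_neq0 ?monic_prod_XsubC.
under eq_bigr do rewrite mu_prod_XsubC.
apply: sum_count_mem; first exact: uniq_roots.
by move=> x xs; rewrite -roots_on_rootsR // root_prod_XsubC.
Qed.

Lemma mxrank_diag n (d : 'rV[R]_n) : \rank (diag_mx d) = #|[pred i | d 0 i != 0]|.
Proof.
rewrite -sum1_card big_mkcond /=.
elim: n d => [|n IHn]; first by move=> d; rewrite big_ord0 thinmx0 mxrank0.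
rewrite -[n.+1]/(1 + n)%N => d; rewrite big_split_ord big_ord1 /=.
rewrite -{1}[d]hsubmxK diag_mx_row rank_diag_block_mx IHn; congr addn.
  rewrite [diag_mx _]mx11_scalar !mxE eqxx mulr1n inE.
  have [->|a0] := eqVneq (d 0 _) 0; first by rewrite raddf0 mxrank0.
  by rewrite mxrank_unit // unitmxE det_scalar1 unitfE.
by apply: eq_bigr => i _; rewrite !inE mxE.
Qed.

Section Orthodiagonal.
Variables (n : nat) (A H : 'M[R]_n) (d : 'rV[R]_n).
Hypotheses (HH : H *m H^T = 1%:M) (HAd : H *m A *m H^T = diag_mx d).

(** The characteristic polynomial is the product of the ['X - d 0 i], so summing root multiplicities
    amounts to counting indices. *)
Lemma sum_mup_orthodiag (P : pred R) :
  (\sum_(x <- rootsR (char_poly A) | P x) mup x (char_poly A))%N =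
  #|[pred i | P (d 0 i)]|.
Proof.
have -> : char_poly A = \prod_(y <- [seq d 0 i | i : 'I_n]) ('X - y%:P).
  rewrite -(char_poly_orthogonal_conj _ HH) HAd char_poly_trig ?diag_mx_is_trig //.
  rewrite big_map big_enum; apply: eq_bigr => i _.
  by rewrite mxE eqxx mulr1n.
rewrite sum_rootsR_mup count_map cardE size_filter.
by rewrite enumT.
Qed.

Lemma i_minus_orthodiag : i_minus A = #|[pred i | d 0 i < 0]|.
Proof. exact: sum_mup_orthodiag. Qed.

Lemma i_plus_orthodiag : i_plus A = #|[pred i | 0 < d 0 i]|.
Proof. exact: sum_mup_orthodiag. Qed.

Lemma rank_orthodiag : \rank A = #|[pred i | d 0 i != 0]|.
Proof.
have Hu : H \in unitmx by have [] := mulmx1_unit HH.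
have HTu : H^T \in unitmx by rewrite unitmx_tr.
have -> : \rank A = \rank (diag_mx d); last exact: mxrank_diag.
by rewrite -HAd mxrankMfree ?row_free_unit // (eqmxMfull _ _) ?row_full_unit.
Qed.
End Orthodiagonal.
End Spectral.

(** * Negative index as maximal dimension of a negative definite subspace, and Sylvester's law *)

Section Inertia.
Variable R : rcfType.

(** When [N *m A *m N^T] is negative definite, the rows of [N] are independent; so [N] stands for a
    subspace of dimension [p] on which the form is negative. *)
Definition negdef p (A : 'M[R]_p) : Prop :=
  forall u : 'rV_p, u != 0 -> (u *m A *m u^T) 0 0 < 0.

Lemma quad_diag n (d w : 'rV[R]_n) :
  (w *m diag_mx d *m w^T) 0 0 = \sum_i d 0 i * w 0 i ^+ 2.
Proof.
rewrite mul_mx_diag mxE; apply: eq_bigr => i _.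
by rewrite !mxE mulrAC mulrC expr2.
Qed.

Lemma tr_conj_sym m n (L : 'M[R]_(m, n)) (A : 'M[R]_n) :
  A^T = A -> (L *m A *m L^T)^T = L *m A *m L^T.
Proof. by move=> As; rewrite !trmx_mul trmxK As mulmxA. Qed.

Lemma conj_conj m n p (L : 'M[R]_(m, n)) (K : 'M_(n, p)) (A : 'M[R]_p) :
  L *m (K *m A *m K^T) *m L^T = (L *m K) *m A *m (L *m K)^T.
Proof. by rewrite trmx_mul !mulmxA. Qed.

Lemma tr_opp_sym n (A : 'M[R]_n) : A^T = A -> (- A)^T = - A.
Proof. by move=> As; rewrite linearN /= As. Qed.

Lemma negdef_leq_i_minus n p (A : 'M[R]_n) (N : 'M_(p, n)) :
  A^T = A -> negdef (N *m A *m N^T) -> (p <= i_minus A)%N.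
Proof.
move=> As Nneg; have [H [d HH HAd]] := symmetric_orthodiag As.
rewrite (i_minus_orthodiag HH HAd).
set k := #|_|; pose e (i : 'I_k) : 'I_n := enum_val i.
(* Coordinates of the rows of [N] along the eigenvectors with negative eigenvalue. A combination of
   rows for which they all vanish has a nonnegative form, hence is trivial. *)
pose G := colsub e (N *m H^T).
suff /eqP <- : row_free G by apply: rank_leq_col.
rewrite -kermx_eq0; apply/rowV0P => u /sub_kermxP uG; apply/eqP.
apply/negPn/negP => /Nneg; apply/negP; rewrite -leNgt.
pose w := u *m N *m H^T.
have -> : u *m (N *m A *m N^T) *m u^T = w *m diag_mx d *m w^T.
  rewrite -HAd /w !trmx_mul trmxK -!mulmxA.
  by rewrite !(mulmxA H^T H) (mulmx1C HH) !mul1mx.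
rewrite quad_diag sumr_ge0 // => i _.
have [di|di] := ltP (d 0 i) 0; last by rewrite mulr_ge0 ?sqr_ge0.
have ik : i \in [pred i | d 0 i < 0] by [].
have -> : w 0 i = 0; last by rewrite expr0n mulr0.
move: uG; rewrite /G mulmx_colsub mulmxA -/w => /rowP /(_ (enum_rank_in ik i)).
by rewrite [LHS]mxE /e enum_rankK_in // [RHS]mxE.
Qed.

(** The eigenvectors with negative eigenvalue span such a subspace. *)
Lemma i_minus_negdef n (A : 'M[R]_n) : A^T = A ->
  exists N : 'M_(i_minus A, n), negdef (N *m A *m N^T).
Proof.
move=> As; have [H [d HH HAd]] := symmetric_orthodiag As.
rewrite (i_minus_orthodiag HH HAd).
set k := #|_|; pose e (i : 'I_k) : 'I_n := enum_val i.
exists (rowsub e H) => u u0.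
have -> : rowsub e H *m A *m (rowsub e H)^T = diag_mx (colsub e d).
  rewrite !mul_rowsub_mx trmx_mxsub mulmx_colsub HAd.
  apply/matrixP => i j; rewrite !mxE.
  by rewrite (inj_eq enum_val_inj).
rewrite quad_diag.
have [j uj] : exists j, u 0 j != 0.
  apply/existsP; apply: contraNT u0; rewrite negb_exists => /forallP u0.
  by apply/eqP/rowP => j; rewrite [RHS]mxE; apply/eqP; move: (u0 j); rewrite negbK.
have dneg i : colsub e d 0 i < 0 by rewrite mxE; have := enum_valP i; rewrite inE.
rewrite (bigD1 j) //= ltr_wnDr //.
  by rewrite sumr_le0 // => i _; rewrite mulr_le0_ge0 ?sqr_ge0 ?ltW.
by rewrite nmulr_rlt0 // exprn_even_gt0 //= uj orbT.
Qed.

Lemma i_minus_le_conj m n (L : 'M[R]_(m, n)) (A : 'M[R]_n) :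
  A^T = A -> (i_minus (L *m A *m L^T) <= i_minus A)%N.
Proof.
move=> As; have [N] := i_minus_negdef (tr_conj_sym L As).
rewrite conj_conj; exact: negdef_leq_i_minus.
Qed.

(** Sylvester's law of inertia: the inequality for [L] and for its inverse. *)
Lemma i_minus_conj_unit n (L A : 'M[R]_n) :
  A^T = A -> L \in unitmx -> i_minus (L *m A *m L^T) = i_minus A.
Proof.
move=> As Lu; apply/eqP; rewrite eqn_leq i_minus_le_conj //=.
have {1}-> : A = invmx L *m (L *m A *m L^T) *m (invmx L)^T.
  by rewrite -!mulmxA -trmx_mul mulVmx // trmx1 mulmx1 mulKmx.
by rewrite i_minus_le_conj // tr_conj_sym.
Qed.

Lemma i_plusE n (A : 'M[R]_n) : A^T = A -> i_plus A = i_minus (- A).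
Proof.
move=> As; have [H [d HH HAd]] := symmetric_orthodiag As.
rewrite (i_plus_orthodiag HH HAd) (@i_minus_orthodiag _ _ _ _ (- d) HH).
  by apply: eq_card => i; rewrite !inE mxE oppr_lt0.
by rewrite mulmxN mulNmx HAd raddfN.
Qed.

Lemma mxrank_inertia n (A : 'M[R]_n) : A^T = A ->
  \rank A = (i_minus A + i_minus (- A))%N.
Proof.
move=> As; have [H [d HH HAd]] := symmetric_orthodiag As.
rewrite -i_plusE // (i_plus_orthodiag HH HAd) (i_minus_orthodiag HH HAd).
rewrite (rank_orthodiag HH HAd) -cardUI [X in (_ + X)%N]eq_card0.
  by rewrite addn0; apply: eq_card => i; rewrite !inE neq_lt.
by move=> i; rewrite !inE; case: ltgtP.
Qed.

Lemma i_minus0 n : i_minus (0 : 'M[R]_n) = 0%N.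
Proof.
have := mxrank_inertia (trmx0 R n n); rewrite mxrank0 => /esym/eqP.
by rewrite addn_eq0 => /andP[/eqP].
Qed.

Lemma i_minus_scale n (A : 'M[R]_n) c :
  A^T = A -> 0 < c -> i_minus (c *: A) = i_minus A.
Proof.
move=> As c0; pose s := Num.sqrt c.
have -> : c *: A = s%:M *m A *m s%:M^T.
  by rewrite tr_scalar_mx mul_scalar_mx mul_mx_scalar scalerA -expr2 sqr_sqrtr ?ltW.
rewrite i_minus_conj_unit // unitmxE det_scalar unitfE expf_neq0 //.
by rewrite gt_eqF ?sqrtr_gt0.
Qed.

Lemma tr_mxdiag_sym m (p_ : 'I_m -> nat) (A_ : forall i, 'M[R]_(p_ i)) :
  (forall i, (A_ i)^T = A_ i) -> (\mxdiag_i A_ i)^T = \mxdiag_i A_ i.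
Proof. by move=> As; rewrite tr_mxdiag; apply: eq_mxdiag. Qed.

Lemma leq_i_minus_mxdiag m (p_ : 'I_m -> nat) (A_ : forall i, 'M[R]_(p_ i)) :
  (forall i, (A_ i)^T = A_ i) ->
  (\sum_i i_minus (A_ i) <= i_minus (\mxdiag_i A_ i))%N.
Proof.
move=> As.
have /fin_all_exists[N Nneg] i := i_minus_negdef (As i).
(* Direct sum of the negative subspaces of the blocks. [conform_mx] only adjusts the type on the
   diagonal, where [j] is [i]; its default is never taken. *)
pose M := \mxblock_(i < m, j < m)
   (if i == j then conform_mx (0 : 'M_(i_minus (A_ i), p_ j)) (N i) else 0).
apply: (@negdef_leq_i_minus _ _ _ M); first by rewrite tr_mxdiag_sym.
have Mmul (u : forall i, 'rV[R]_(i_minus (A_ i))) :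
    \mxrow_i u i *m M = \mxrow_i (u i *m N i).
  rewrite /M mul_mxrow_mxblock; apply: eq_mxrow => j.
  rewrite (bigD1 j) //= eqxx conform_mx_id big1 ?addr0 // => i ij.
  by rewrite (negPf ij) mulmx0.
move=> u u0; pose v i : 'rV_(i_minus (A_ i)) := submxrow u i.
have -> : u *m (M *m \mxdiag_i A_ i *m M^T) *m u^T =
   \sum_i v i *m (N i *m A_ i *m (N i)^T) *m (v i)^T.
  rewrite !mulmxA -[_ *m M^T *m _]mulmxA -trmx_mul -[u]submxrowK Mmul.
  rewrite mul_mxrow_mxdiag tr_mxrow mul_mxrow_mxcol; apply: eq_bigr => i _.
  by rewrite trmx_mul !mulmxA.
have vle i : (v i *m (N i *m A_ i *m (N i)^T) *m (v i)^T) 0 0 <= 0.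
  have [->|vi] := eqVneq (v i) 0; first by rewrite !mul0mx mxE.
  by rewrite ltW // Nneg.
have [j vj] : exists j, v j != 0.
  apply/existsP; apply: contraNT u0; rewrite negb_exists => /forallP u0.
  rewrite -[u]submxrowK; apply/eqP; rewrite -[RHS]mxrow0; apply: eq_mxrow => j.
  by apply/eqP; move: (u0 j); rewrite negbK.
rewrite summxE (bigD1 j) //= ltr_wnDr ?sumr_le0 //; last exact: Nneg.
Qed.

(** Rank is additive and equals the sum of the negative indices of the matrix and its opposite; as
    these two lower bounds add up to an equality, both are sharp. *)
Lemma i_minus_mxdiag m (p_ : 'I_m -> nat) (A_ : forall i, 'M[R]_(p_ i)) :
  (forall i, (A_ i)^T = A_ i) ->
  i_minus (\mxdiag_i A_ i) = (\sum_i i_minus (A_ i))%N.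
Proof.
move=> As; have := rank_mxdiag A_.
rewrite mxrank_inertia ?tr_mxdiag_sym //.
under [RHS]eq_bigr do rewrite mxrank_inertia //.
rewrite big_split /= -mxdiagN => e.
have le1 := leq_i_minus_mxdiag As.
have le2 := leq_i_minus_mxdiag (fun i => tr_opp_sym (As i)).
apply/eqP; rewrite eqn_leq le1 andbT.
by rewrite -(leq_add2r (i_minus (\mxdiag_i (- A_ i)))) e leq_add2l.
Qed.

(* The rows of [Z] span an isotropic subspace and those of [K] its orthogonal;
   each dimension of the pairing with [Z] splits off a hyperbolic plane. *)
Lemma i_minus_isotropic n p q (A : 'M[R]_n) (Z : 'M_(p, n)) (K : 'M_(q, n)) :
  A^T = A -> Z *m A *m Z^T = 0 -> K *m A *m Z^T = 0 ->
  (kermx (A *m Z^T) <= K)%MS ->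
  i_minus A = (\rank (A *m Z^T) + i_minus (K *m A *m K^T))%N.
Proof.
move=> As ZAZ KAZ kerK; set B := A *m Z^T.
apply/eqP; rewrite eqn_leq; apply/andP; split.
  have [N Nneg] := i_minus_negdef As.
  (* [Q *m N] spans the part of the negative subspace orthogonal to [Z]; it lies in [K], and its
     codimension is at most the rank of the pairing. *)
  pose Q := row_base (kermx (N *m B)).
  have /submxP[L QNL] : (Q *m N <= K)%MS.
    apply: submx_trans kerK; apply/sub_kermxP; rewrite -/B -mulmxA.
    by apply/sub_kermxP; rewrite eq_row_base.
  have : (\rank (kermx (N *m B)) <= i_minus (K *m A *m K^T))%N.
    apply: (@negdef_leq_i_minus _ _ _ L); first exact: tr_conj_sym.
    rewrite conj_conj -QNL -conj_conj => u u0; rewrite (conj_conj u).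
    apply: Nneg; apply: contra u0 => /eqP uQ; apply/eqP.
    by apply: (row_free_inj (row_base_free _)); rewrite uQ mul0mx.
  rewrite mxrank_ker leq_subLR => /leq_trans; apply.
  by rewrite leq_add2r mxrankM_maxr.
(* For the converse, [S] and the isotropic rows [Y = D^T *m Z] are put in duality, one pair for each
   unit of rank of [B]. *)
have /row_fullP[S SB] := col_base_full B.
have /row_freeP[D BD] := row_base_free B.
have SBD : S *m B *m D = 1%:M.
  by rewrite -[X in S *m X]mulmx_base mulmxA SB mul1mx BD.
pose Y := D^T *m Z.
have BY : B *m D = A *m Y^T by rewrite /Y trmx_mul trmxK mulmxA.
have SAY : S *m A *m Y^T = 1%:M by rewrite -mulmxA -BY mulmxA.
have tA k l (U : 'M_(k, n)) (V : 'M_(l, n)) : U *m A *m V^T = (V *m A *m U^T)^T.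
  by rewrite !trmx_mul trmxK As mulmxA.
have YAS : Y *m A *m S^T = 1%:M by rewrite tA SAY trmx1.
have ZB : Z *m B = 0 by rewrite /B mulmxA.
have KB : K *m B = 0 by rewrite /B mulmxA.
have YAY : Y *m A *m Y^T = 0.
  by rewrite -mulmxA -BY mulmxA /Y -(mulmxA _ Z) ZB mulmx0 mul0mx.
have KAY : K *m A *m Y^T = 0 by rewrite -mulmxA -BY mulmxA KB mul0mx.
have YAK : Y *m A *m K^T = 0 by rewrite tA KAY trmx0.
move: (Y) SAY YAS YAY KAY => {YAK BY Y} Y SAY YAS YAY KAY.
have [N Nneg] := i_minus_negdef (tr_conj_sym K As).
move: (i_minus (K *m A *m K^T)) N Nneg => k N Nneg.
have [T TE] : {T | T = N *m K} by eexists.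
(* Coefficients of corrections by isotropic rows: subtracting [C *m Y] from [T] makes it orthogonal
   to [M2], and [G] solves [S *m A *m S^T - 2 G = -1], the form wanted on [M2]. *)
have [C CE] : {C | C = T *m A *m S^T} by eexists.
have [G GE] : {G | G = 2^-1 *: (S *m A *m S^T + 1%:M)} by eexists.
have GT : G^T = G by rewrite GE linearZ linearD /= tr_conj_sym // trmx1.
have TAY : T *m A *m Y^T = 0 by rewrite TE -!mulmxA (mulmxA K) KAY mulmx0.
have YAT : Y *m A *m T^T = 0 by rewrite tA TAY trmx0.
have {}YAS E (X : 'M_(E, _)) : X *m Y *m A *m S^T = X.
  by rewrite -!mulmxA (mulmxA Y) YAS mulmx1.
have {}YAT E (X : 'M_(E, _)) : X *m Y *m A *m T^T = 0.
  by rewrite -!mulmxA (mulmxA Y) YAT mulmx0.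
have {}YAY E (X : 'M_(E, _)) : X *m Y *m A *m Y^T = 0.
  by rewrite -!mulmxA (mulmxA Y) YAY mulmx0.
pose M1 := T - C *m Y; pose M2 := S - G *m Y.
have M1T : M1^T = T^T - Y^T *m C^T by rewrite linearB /= trmx_mul.
have M2T : M2^T = S^T - Y^T *m G by rewrite linearB /= trmx_mul GT.
have M11 : M1 *m A *m M1^T = N *m (K *m A *m K^T) *m N^T.
  rewrite conj_conj -TE M1T !mulmxBl !mulmxBr !mulmxA TAY YAT YAY.
  by rewrite !mul0mx !subr0.
have M12 : M1 *m A *m M2^T = 0.
  rewrite M2T !mulmxBl !mulmxBr !mulmxA TAY YAS YAY -CE.
  by rewrite !mul0mx !subr0 subrr.
have M22 : M2 *m A *m M2^T = - 1%:M.
  rewrite M2T !mulmxBl !mulmxBr !mulmxA SAY YAS YAY mul1mx mul0mx subr0.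
  rewrite -addrA -opprD GE -scalerDl (_ : 2^-1 + 2^-1 = 1); last by field.
  by rewrite scale1r opprD addNKr.
apply: (@negdef_leq_i_minus _ _ _ (col_mx M2 M1)) => // u u0.
rewrite conj_conj -[u]hsubmxK; set a := lsubmx u; set b := rsubmx u.
have bab : (a != 0) || (b != 0).
  rewrite -negb_and; apply: contra u0 => /andP[/eqP a0 /eqP b0].
  by rewrite -[u]hsubmxK -/a -/b a0 b0 row_mx0.
clearbody M1 M2; have M21 : M2 *m A *m M1^T = 0 by rewrite tA M12 trmx0.
have -> : (row_mx a b *m col_mx M2 M1) *m A *m (row_mx a b *m col_mx M2 M1)^T =
    b *m (M1 *m A *m M1^T) *m b^T - a *m a^T.
  rewrite mul_row_col linearD /= !trmx_mul !mulmxDl !mulmxDr !mulmxA.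
  have cj k1 k2 k3 (x : 'M_(k1, k2)) (U : 'M_(k2, n)) (V : 'M_(k3, n)) :
    x *m U *m A *m V^T = x *m (U *m A *m V^T) by rewrite !mulmxA.
  rewrite (cj _ _ _ a M2 M2) (cj _ _ _ a M2 M1) (cj _ _ _ b M1 M2) M22 M21 M12.
  by rewrite !mulmx0 !mul0mx mulmxN mulmx1 mulNmx addr0 add0r addrC.
rewrite M11 mxE [X in _ + X]mxE.
have ale : 0 <= (a *m a^T) 0 0.
  by have [->|/rV_sqr_gt0/ltW//] := eqVneq a 0; rewrite mul0mx mxE.
have [b0|/Nneg bneg] := eqVneq b 0; last by rewrite ltr_wnDr ?oppr_le0.
by rewrite b0 !mul0mx mxE add0r oppr_lt0 rV_sqr_gt0 //; move: bab; rewrite b0 eqxx orbF.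
Qed.
End Inertia.

(** * Common transversal of finitely many frames, and their representation as graphs *)

Section Frames.
Variables (R : rcfType) (n : nat).
Implicit Types Y Z : 'M[R]_(n + n, n).

Lemma wronskianE Y Z :
  wronskian Y Z = (usubmx Y)^T *m dsubmx Z - (dsubmx Y)^T *m usubmx Z.
Proof.
rewrite /wronskian /Jmx -{1}[Y]vsubmxK -{1}[Z]vsubmxK tr_col_mx.
rewrite mul_row_block !mulmx0 mulmxN !mulmx1 add0r addr0 mul_row_col.
by rewrite addrC mulNmx.
Qed.

Lemma frame_sym Y : frame Y ->
  (usubmx Y)^T *m dsubmx Y = (dsubmx Y)^T *m usubmx Y.
Proof. by move=> [+ _]; rewrite wronskianE => /eqP; rewrite subr_eq0 => /eqP. Qed.

Lemma frame_gram_unit Y : frame Y -> Y^T *m Y \in unitmx.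
Proof.
move=> [_ rY]; rewrite -{2}[Y]trmxK; apply: row_free_gram_unit.
by rewrite /row_free mxrank_tr rY.
Qed.

Lemma poly_square_nonroot (p : {poly R}) : p != 0 -> exists t, p.[t ^+ 2] != 0.
Proof.
move=> p0; pose s := [seq (i%:R : R) ^+ 2 | i <- iota 0 (size p)].
have Us : uniq s.
  rewrite map_inj_uniq ?iota_uniq // => i j /eqP.
  by rewrite eqrXn2 ?ler0n // eqr_nat => /eqP.
have /allPn[x /mapP[i _ ->] xr] : ~~ all (root p) s.
  apply/negP => /(max_poly_roots p0) /(_ Us).
  by rewrite size_map size_iota ltnn.
by exists i%:R.
Qed.

(** Invertibility says that the Lagrangian subspace of the pairs (x, t x) is transversal to each
    frame. By symmetry of [X^T U], the product of [(U + t X)^T] and [U - t X] is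
    [U^T U - t^2 X^T X], whose determinant is a polynomial in [t^2]; a square avoiding all its roots
    is enough. *)
Lemma transversal_exists (I : finType) (Y : I -> 'M[R]_(n + n, n)) :
  (forall k, frame (Y k)) ->
  exists t, forall k, dsubmx (Y k) - t *: usubmx (Y k) \in unitmx.
Proof.
move=> fY; pose X k := usubmx (Y k); pose U k := dsubmx (Y k).
pose q k := \det (map_mx polyC ((U k)^T *m U k) - 'X *: map_mx polyC ((X k)^T *m X k)).
have qE k s : (q k).[s] = \det ((U k)^T *m U k - s *: ((X k)^T *m X k)).
  rewrite -[LHS]/(horner_eval s _) -det_map_mx; congr (\det _).
  by apply/matrixP => i j; rewrite !mxE /= /horner_eval !hornerE.
(* [q k] is nonzero at -1, where it is the Gram determinant of [Y k]. *)
have q0 : \prod_k q k != 0.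
  apply/prodf_neq0 => k _; apply/eqP => qk0.
  have := frame_gram_unit (fY k); rewrite unitmxE unitfE.
  suff -> : (Y k)^T *m Y k = (U k)^T *m U k - -1 *: ((X k)^T *m X k).
    by rewrite -qE qk0 horner0 eqxx.
  rewrite scaleN1r opprK -{1 2}[Y k]vsubmxK tr_col_mx mul_row_col addrC //.
have [t] := poly_square_nonroot q0; rewrite horner_prod => /prodf_neq0 qt.
exists t => k; rewrite -/(U k) -/(X k) unitmxE unitfE.
have := qt k isT; rewrite qE; apply: contraNN => /eqP d0.
have -> : (U k)^T *m U k - t ^+ 2 *: ((X k)^T *m X k) =
          (U k + t *: X k)^T *m (U k - t *: X k).
  rewrite [(_ + _)^T]linearD /= [(t *: _)^T]linearZ /= mulmxDl !mulmxBr.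
  rewrite -!scalemxAl -!scalemxAr scalerA.
  by rewrite (frame_sym (fY k)) addrA subrK expr2.
by rewrite det_mulmx d0 mulr0.
Qed.

(** The map from (X, U) to (U - t X, -X) is symplectic and sends the chosen subspace to the vertical
    one. With [F] the new upper block, normalizing it to 1 leaves the lower block [Q = - X F^-1],
    symmetric by the frame condition. *)
Lemma frames_graph (I : finType) (Y : I -> 'M[R]_(n + n, n)) :
  (forall k, frame (Y k)) ->
  exists F Q : I -> 'M[R]_n,
    [/\ forall k, F k \in unitmx, forall k, (Q k)^T = Q k &
        forall i j, wronskian (Y i) (Y j) = (F i)^T *m (Q j - Q i) *m F j].
Proof.
move=> fY; have [t tu] := transversal_exists fY.
pose X k := usubmx (Y k).
have [F FE] : {F | forall k, F k = dsubmx (Y k) - t *: X k} by eexists.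
have Fu k : F k \in unitmx by rewrite FE.
have FX k : (F k)^T *m X k = (X k)^T *m F k.
  rewrite FE [(_ - _)^T]linearB /= [(t *: _)^T]linearZ /= mulmxBl mulmxBr.
  rewrite -scalemxAl -scalemxAr.
  by rewrite (frame_sym (fY k)).
exists F, (fun k => - (X k *m invmx (F k))); split=> // [k|i j].
  have FTu : (F k)^T \in unitmx by rewrite unitmx_tr Fu.
  rewrite linearN /= trmx_mul trmx_inv; congr (- _).
  apply: (can_inj (mulKmx FTu)); rewrite mulKVmx // mulmxA FX mulmxK ?Fu //.
rewrite /= opprK mulmxDr mulmxDl mulmxN mulNmx -!mulmxA mulVmx ?Fu // mulmx1.
rewrite mulmxA FX -!mulmxA mulKVmx ?Fu // wronskianE -/(X i) -/(X j) !FE.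
rewrite [(_ - _)^T]linearB /= [(t *: _)^T]linearZ /= mulmxBl mulmxBr.
rewrite -scalemxAl -scalemxAr.
by rewrite opprB [RHS]addrC addrA subrK.
Qed.

(** * Block diagonalization of [Smx] by cyclic differences *)

Section Cyclic.
Variable m : nat.
Implicit Types i j k : 'I_m.+1.

(** Coefficient of the component [i] in [2 u_k], where [u_k] is the partial sum up to [k] minus half
    of the total. *)
Definition step_sign k i : R := if (i <= k)%N then 1 else -1.

Lemma cyclic_telescope (Q : 'I_m.+1 -> 'M[R]_n) : \sum_k (Q (ordS k) - Q k) = 0.
Proof.
rewrite sumrB [X in _ - X](reindex_inj (bij_inj (ordS_bij _))) /=.
by rewrite subrr.
Qed.

(** The product of the two signs is -1 exactly for [i <= k < j]. So the coefficient is the indicator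
    of this interval minus 1/2, and the constant part disappears with the cyclic sum. *)
Lemma step_telescope (Q : 'I_m.+1 -> 'M[R]_n) i j : (i <= j)%N ->
  \sum_k (- 2^-1 * (step_sign k i * step_sign k j)) *: (Q (ordS k) - Q k) =
  Q j - Q i.
Proof.
move=> ij; pose D k := Q (ordS k) - Q k.
have -> : \sum_k (- 2^-1 * (step_sign k i * step_sign k j)) *: D k =
          \sum_(k < m.+1 | (i <= k < j)%N) D k - 2^-1 *: \sum_k D k.
  rewrite scaler_sumr -sumrN [in RHS]big_mkcond -big_split /=.
  apply: eq_bigr => k _; rewrite /step_sign -scaleNr.
  have [ik|ki] := leqP i k; have [jk|kj] := leqP j k => /=.
  - by rewrite add0r !mulr1.
  - by rewrite -[X in X + _]scale1r -scalerDl; congr (_ *: _); field.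
  - by have := leq_trans ij jk; rewrite leqNgt ki.
  - by rewrite add0r mulrNN !mulr1.
rewrite cyclic_telescope scaler0 subr0.
(* [inord] makes [Q] a sequence on the naturals; as [k < j <= m], [ordS k] is [k + 1] without
   wrapping around. *)
pose q (k : nat) := Q (inord k).
rewrite (eq_bigr (fun k : 'I_m.+1 => q k.+1 - q k)); last first.
  move=> k /andP[_ kj]; rewrite /D /q inord_val; congr (Q _ - _); apply: val_inj => /=.
  by rewrite inordK ?modn_small // ltnS (leq_trans kj) // -ltnS.
transitivity (\sum_(i <= k < j) (q (k : nat).+1 - q k)); last first.
  by rewrite telescope_sumr // /q !inord_val.
rewrite big_geq_mkord.
rewrite (big_ord_widen_cond m.+1 (fun k : nat => i <= k)%N
  (fun k : nat => q k.+1 - q k)) //.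
by rewrite ltnW.
Qed.

(** Recovers the components: [u_i - u_(i-1)] is the component [i], while for [i = 0] the predecessor
    is the last index, [u_m] is half of the total, and a sum replaces the difference. *)
Lemma step_sign_pred i j :
  step_sign i j + (if i == ord0 then 1 else -1) * step_sign (ord_pred i) j =
  (i == j)%:R *+ 2.
Proof.
have pE : (ord_pred i : nat) = if i == ord0 then m else i.-1.
  rewrite /= -val_eqE /=; case: i => [[|i] im] /=; first by rewrite modn_small.
  by rewrite modnDr modn_small // ltnW.
rewrite /step_sign pE -!val_eqE /=; case: (eqVneq (i : nat) 0%N) => [->|i0].
  have jm : (j <= m)%N by rewrite -ltnS.
  by rewrite jm leqn0 mul1r eq_sym; case: eqP => _; rewrite mulr2n // addNr addr0.
have -> : (j <= i.-1)%N = (j < i)%N by rewrite -ltnS prednK // lt0n.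
by case: ltngtP => _; rewrite mulr2n mulN1r ?subrr ?opprK ?addNr ?addr0.
Qed.

Lemma scale_mxblock c (B : 'I_m.+1 -> 'I_m.+1 -> 'M[R]_n) :
  c *: \mxblock_(i, j) B i j = \mxblock_(i, j) (c *: B i j).
Proof. by apply/matrixP => i j; rewrite !mxE. Qed.

Lemma i_minus_Smx (Y : 'I_m.+1 -> 'M[R]_(n + n, n)) (F Q : 'I_m.+1 -> 'M[R]_n) c :
  (forall k, F k \in unitmx) -> (forall k, (Q k)^T = Q k) ->
  (forall i j, wronskian (Y i) (Y j) = (F i)^T *m (Q j - Q i) *m F j) ->
  i_minus (c *: Smx Y) = (\sum_k i_minus (- c *: (Q (ordS k) - Q k)))%N.
Proof.
move=> Fu Qs wE.
pose D k := Q (ordS k) - Q k.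
have Ds' i j : (Q i - Q j)^T = Q i - Q j by rewrite linearB /= !Qs.
have Ds k : (D k)^T = D k by apply: Ds'.
pose E k := 2^-1 *: (- c *: D k).
have Es k : (E k)^T = E k by rewrite !linearZ /= Ds.
(* [B] maps the components to [2 u_k], in the notation of the header. *)
pose B := \mxblock_(k < m.+1, i < m.+1) (step_sign k i *: F i).
have BE : c *: Smx Y = B^T *m (\mxdiag_k E k) *m B^T^T.
  rewrite trmxK /B tr_mxblock mul_mxblock_mxdiag mul_mxblock /Smx scale_mxblock.
  apply: eq_mxblock => i j.
  transitivity (c *: ((F i)^T *m
      (\sum_k (- 2^-1 * (step_sign k i * step_sign k j)) *: D k) *m F j)).
    congr (_ *: _); case: ltngtP => ij.
    - by rewrite wE step_telescope // ltnW.
    - under eq_bigr do rewrite [step_sign _ i * _]mulrC.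
      by rewrite step_telescope ?(ltnW ij) // wE !trmx_mul trmxK Ds' mulmxA.
    - have <- : i = j by apply: val_inj.
      by rewrite step_telescope // subrr mulmx0 mul0mx.
  rewrite mulmx_sumr mulmx_suml scaler_sumr; apply: eq_bigr => k _.
  rewrite [(_ *: F i)^T]linearZ /= -!(scalemxAl, scalemxAr) !scalerA; congr (_ *: _).
  by ring.
have Bu : B^T \in unitmx.
  rewrite unitmx_tr.
  (* Inverse of [B], read off from [step_sign_pred]. *)
  pose C := \mxblock_(i < m.+1, k < m.+1)
    ((2^-1 * ((k == i)%:R + (if i == ord0 then 1 else -1) * (k == ord_pred i)%:R))
        *: invmx (F i)).
  suff /mulmx1_unit[] : C *m B = 1%:M by [].
  rewrite /C /B mul_mxblock -mxdiagZ; apply: eq_mxblock => i j.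
  transitivity ((2^-1 * (step_sign i j +
      (if i == ord0 then 1 else -1) * step_sign (ord_pred i) j)) *:
      (invmx (F i) *m F j)).
    under eq_bigr do rewrite -scalemxAl -scalemxAr scalerA -mulrA mulrDl.
    rewrite -scaler_suml -mulr_sumr big_split /=; congr (_ * (_ + _) *: _).
      rewrite (bigD1 i) //= eqxx mul1r big1 ?addr0 // => k ki.
      by rewrite (negPf ki) mul0r.
    rewrite (bigD1 (ord_pred i)) //= eqxx mulr1 big1 ?addr0 // => k ki.
    by rewrite (negPf ki) mulr0 mul0r.
  rewrite step_sign_pred conform_mx_id; case: eqVneq => [<-|_].
    by rewrite mulVmx // -mulr_natl mulr1 mulVf ?pnatr_eq0 // scale1r.
  by rewrite mul0rn mulr0 scale0r.
rewrite BE (i_minus_conj_unit (tr_mxdiag_sym Es) Bu) i_minus_mxdiag //.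
by apply: eq_bigr => k _; rewrite i_minus_scale ?invr_gt0 ?ltr0n // linearZ /= Ds.
Qed.
End Cyclic.
End Frames.

(** * Triples of frames whose last member is vertical *)

Section Triple.
Variables (R : rcfType) (n : nat).

(** Literal family of three entries; nested, it writes 3 by 3 block matrices row by row. *)
Definition of3 (T : Type) (a b c : T) (i : 'I_3) : T :=
  match val i with 0 => a | 1 => b | _ => c end.

Lemma trmx_mul3 (A B C : 'M[R]_n) : (A *m B *m C)^T = C^T *m B^T *m A^T.
Proof. by rewrite !trmx_mul mulmxA. Qed.

Lemma ord3P (i : 'I_3) : [\/ i = 0, i = 1 | i = ord_max].
Proof.
by case: i => [[|[|[|//]]] ?]; [constructor 1|constructor 2|constructor 3];
   apply: val_inj.
Qed.

Lemma mxblock3P (A B : 'I_3 -> 'I_3 -> 'M[R]_n) :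
  A 0 0 = B 0 0 -> A 0 1 = B 0 1 -> A 0 ord_max = B 0 ord_max ->
  A 1 0 = B 1 0 -> A 1 1 = B 1 1 -> A 1 ord_max = B 1 ord_max ->
  A ord_max 0 = B ord_max 0 -> A ord_max 1 = B ord_max 1 ->
  A ord_max ord_max = B ord_max ord_max ->
  \mxblock_(i, j) A i j = \mxblock_(i, j) B i j.
Proof.
move=> e00 e01 e02 e10 e11 e12 e20 e21 e22; apply: eq_mxblock => i j.
by case: (ord3P i) => ->; case: (ord3P j) => ->.
Qed.

Lemma big_ord3 (T : Type) (idx : T) (op : Monoid.law idx) (f : 'I_3 -> T) :
  \big[op/idx]_i f i = op (f 0) (op (f 1) (f ord_max)).
Proof.
rewrite 3!big_ord_recl big_ord0 Monoid.mulm1.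
by congr (op _ (op (f _) (f _))); apply: val_inj.
Qed.

Definition vertical_frame : 'M[R]_(n + n, n) := col_mx 0 1%:M.

Lemma frame_vertical : frame vertical_frame.
Proof.
split; first by rewrite wronskianE col_mxKu col_mxKd trmx0 mul0mx mulmx0 subrr.
by rewrite rank_col_0mx mxrank1.
Qed.

Lemma wronskian_vertical (Y : 'M[R]_(n + n, n)) :
  wronskian Y vertical_frame = (usubmx Y)^T.
Proof. by rewrite wronskianE col_mxKu col_mxKd mulmx0 mulmx1 subr0. Qed.

Lemma tr_Smx m (Y : 'I_m -> 'M[R]_(n + n, n)) : (Smx Y)^T = Smx Y.
Proof.
rewrite /Smx tr_mxblock; apply: eq_mxblock => i j.
by case: ltngtP => _; rewrite ?trmxK ?trmx0.
Qed.

Lemma Smx3E (Y0 Y1 Y2 : 'M[R]_(n + n, n)) :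
  Smx (of3 Y0 Y1 Y2) = \mxblock_(i < 3, j < 3)
    of3 (of3 0 (wronskian Y0 Y1) (wronskian Y0 Y2))
        (of3 (wronskian Y0 Y1)^T 0 (wronskian Y1 Y2))
        (of3 (wronskian Y0 Y2)^T (wronskian Y1 Y2)^T 0) i j.
Proof. exact: mxblock3P. Qed.

(** * Comparative index of a pair from the triple with the vertical frame *)

Section Pair.
Variables Y Z : 'M[R]_(n + n, n).
Hypotheses (fY : frame Y) (fZ : frame Z).
Let X := usubmx Y.
Let X' := usubmx Z.
Let U := dsubmx Y.
Let U' := dsubmx Z.
Let Xp := mp_pinv X.
Let w := wronskian Y Z.
Let M := Mmx Y Z.
Let T := Tmx Y Z.
Let P := Pmx Y Z.
(** Orthogonal projector onto the kernel of [X]; likewise [H] projects onto the complement of the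
    range of [X], and [T] onto the kernel of [M]. *)
Let G := 1%:M - Xp *m X.
Let H := 1%:M - X *m Xp.

Let XXpX : X *m Xp *m X = X.
Proof. by have /and4P[/eqP] := mp_pinvP X. Qed.
Let XXp_sym : (X *m Xp)^T = X *m Xp.
Proof. by have /and4P[_ _ /eqP] := mp_pinvP X. Qed.
Let XpX_sym : (Xp *m X)^T = Xp *m X.
Proof. by have /and4P[_ _ _ /eqP] := mp_pinvP X. Qed.

Let G_sym : G^T = G. Proof. by rewrite /G linearB /= trmx1 XpX_sym. Qed.
Let H_sym : H^T = H. Proof. by rewrite /H linearB /= trmx1 XXp_sym. Qed.
Let XG : X *m G = 0. Proof. by rewrite mulmxBr mulmx1 mulmxA XXpX subrr. Qed.
Let HX : H *m X = 0. Proof. by rewrite mulmxBl mul1mx XXpX subrr. Qed.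
Let GXT : G *m X^T = 0.
Proof. by apply: trmx_inj; rewrite trmx_mul trmxK G_sym XG trmx0. Qed.
Let XTH : X^T *m H = 0.
Proof. by apply: trmx_inj; rewrite trmx_mul trmxK H_sym HX trmx0. Qed.
Let HH : H *m H = H.
Proof. by rewrite {2}/H mulmxBr mulmx1 mulmxA HX mul0mx subr0. Qed.

Let T_sym : T^T = T.
Proof.
have /and4P[_ _ _ /eqP e] := mp_pinvP M.
by rewrite /T /Tmx -/M linearB /= trmx1 e.
Qed.
Let MT : M *m T = 0.
Proof.
have /and4P[/eqP e _ _ _] := mp_pinvP M.
by rewrite /T /Tmx -/M mulmxBr mulmx1 mulmxA e subrr.
Qed.

Let XTU : X^T *m U = U^T *m X. Proof. exact: frame_sym. Qed.
Let wE : w = X^T *m U' - U^T *m X'. Proof. exact: wronskianE. Qed.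
Let ME : M = - (G *m U^T *m X').
Proof.
by rewrite /M /Mmx -/w -/X -/Xp -/G wE mulmxBr mulmxA GXT mul0mx add0r mulmxA.
Qed.

Let GUH : G *m U^T *m H = G *m U^T.
Proof.
by rewrite /H mulmxBr mulmx1 !mulmxA -(mulmxA G) -XTU mulmxA GXT !mul0mx subr0.
Qed.

(* [U] maps [ker X] onto the orthogonal complement of the range of [X]. *)
Let H_sub_GU : (H <= G *m U^T)%MS.
Proof.
(* Full rank of [Y] makes [U] injective on the kernel of [X]; the inclusion [GUsub] is then an
   equality by dimension. *)
have rGU : \rank (G *m U^T) = \rank G.
  apply/mxrank_injP/rowV0P => v; rewrite sub_capmx => /andP[/submxP[u uE]].
  move/sub_kermxP => vU.
  have vX : v *m X^T = 0 by rewrite uE -mulmxA GXT mulmx0.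
  have : v *m (Y^T *m Y) = 0.
    by rewrite mulmxA -[Y]vsubmxK tr_col_mx mul_mx_row vU vX row_mx0 mul0mx.
  move/(congr1 (mulmx^~ (invmx (Y^T *m Y)))).
  by rewrite mulmxK ?frame_gram_unit // mul0mx.
have GUsub : (G *m U^T <= H)%MS by rewrite -GUH submxMl.
rewrite -(mxrank_leqif_sup GUsub).2 rGU.
have -> : \rank G = \rank (kermx X^T).
  apply/eqP; rewrite eqn_leq; apply/andP; split; apply: mxrankS.
    exact/sub_kermxP.
  rewrite (_ : kermx X^T = kermx X^T *m G) ?submxMl // mulmxBr mulmx1.
  by rewrite -XpX_sym trmx_mul mulmxA mulmx_ker mul0mx subr0.
have -> : \rank H = \rank (kermx X).
  apply/eqP; rewrite eqn_leq; apply/andP; split; apply: mxrankS.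
    exact/sub_kermxP.
  rewrite (_ : kermx X = kermx X *m H) ?submxMl // mulmxBr mulmx1.
  by rewrite mulmxA mulmx_ker mul0mx subr0.
by rewrite !mxrank_ker mxrank_tr.
Qed.

(** [H] factors through [G *m U^T], so [H *m X'] factors through [M], which [T] kills. Thus
    [X' *m T] takes values in the range of [X]. *)
Let HX'T : H *m X' *m T = 0.
Proof.
have /submxP[L ->] := H_sub_GU.
rewrite -!mulmxA (mulmxA G) (mulmxA (G *m _)) -[G *m U^T *m X']opprK -ME.
by rewrite mulNmx MT oppr0 mulmx0.
Qed.

Let rankHX' : \rank (H *m X') = \rank M.
Proof.
apply/eqP; rewrite eqn_leq; apply/andP; split.
  have /submxP[L ->] := H_sub_GU.
  by rewrite -mulmxA -[G *m U^T *m X']opprK -ME mulmxN mxrank_opp mxrankM_maxr.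
by rewrite ME mxrank_opp -GUH -mulmxA mxrankM_maxr.
Qed.

Let TX'H : T *m X'^T *m H = 0.
Proof. by apply: trmx_inj; rewrite !trmx_mul trmxK H_sym T_sym mulmxA HX'T trmx0. Qed.

Let XXpE : X *m Xp *m (X' *m T) = X' *m T.
Proof.
apply/eqP; rewrite -subr_eq0 -opprB oppr_eq0; apply/eqP.
by rewrite -[X in X - _]mul1mx -mulmxBl -/H mulmxA HX'T.
Qed.

(** [P] is a difference of congruences of [U'^T X'] and [X^T U], both symmetric by the frame
    conditions. *)
Let P_sym : P^T = P.
Proof.
pose E := X' *m T.
have PE : P = T *m (U'^T *m X') *m T - (Xp *m E)^T *m (X^T *m U) *m (Xp *m E).
  rewrite /P /Pmx -/T -/w -/X -/Xp -/X' wE [(_ - _)^T]linearB /= !trmx_mul !trmxK.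
  have dist (t f g x y : 'M[R]_n) :
    t *m (f - g) *m x *m y *m t = t *m f *m x *m y *m t - t *m g *m x *m y *m t.
    by rewrite mulmxBr !mulmxBl.
  rewrite dist; congr (_ - _); first by rewrite -!mulmxA (mulmxA X) XXpE.
  have {1}-> : T *m (X'^T *m U) = (Xp *m E)^T *m (X^T *m U); last first.
    by rewrite /E !trmx_mul !mulmxA.
  rewrite !mulmxA; congr (_ *m _).
  by rewrite -[RHS]trmx_mul -!mulmxA (mulmxA X) XXpE trmx_mul T_sym.
have tB (f g : 'M[R]_n) : (f - g)^T = f^T - g^T by rewrite linearB.
rewrite PE tB !trmx_mul3 trmxK T_sym !trmx_mul !trmxK -XTU; congr (T *m _ *m T - _).
exact: (frame_sym fZ).
Qed.

(** Modulo the rows of [X^T], [X'^T] reduces to [X'^T *m H], whose rows are orthogonal to them. *)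
Let rank_col : \rank (X^T + X'^T)%MS = (\rank X + \rank M)%N.
Proof.
have -> : \rank (X^T + X'^T)%MS = \rank (X^T + X'^T *m H)%MS.
  apply/eqP; rewrite eqn_leq; apply/andP; split; apply: mxrankS.
    rewrite addsmx_sub addsmxSl /=.
    have {1}-> : X'^T = X'^T *m Xp^T *m X^T + X'^T *m H.
      by rewrite -mulmxA -trmx_mul XXp_sym -mulmxDr addrC subrK mulmx1.
    by rewrite addmx_sub_adds // submxMl.
  rewrite addsmx_sub addsmxSl mulmxBr mulmx1.
  rewrite addmx_sub ?addsmxSr // -mulNmx -XXp_sym trmx_mul mulmxA.
  by rewrite (submx_trans (submxMl _ _)) // addsmxSl.
rewrite mxrank_disjoint_sum.
  by rewrite mxrank_tr -(mxrank_tr (X'^T *m H)) trmx_mul trmxK H_sym rankHX'.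
apply/eqP/rowV0P => v; rewrite sub_capmx => /andP[/submxP[a aE] /submxP[b bE]].
have : v *m H = v by rewrite bE -!mulmxA HH.
by rewrite aE -mulmxA XTH mulmx0 => <-.
Qed.

(** Isotropic reduction along the third component [V]: the pairing with it has rank
    [\rank X + \rank M], and on its orthogonal, spanned by the rows of [K], the form of [S] is
    [-2 P] plus zero blocks. *)
Lemma i_minus_triple c : c != 0 ->
  i_minus (c *: Smx (of3 Y Z vertical_frame)) =
  (\rank X + (\rank M + i_minus (- c *: P)))%N.
Proof.
move=> c0; set S := Smx _.
(* Chosen to solve [a *m X^T + T *m X'^T = 0], that is, orthogonality of the first row of [K] to
   [V]. *)
pose a := - (T *m X'^T *m Xp^T).
pose K := \mxblock_(i < 3, j < 3) of3 (of3 a T 0) (of3 G 0 0) (of3 0 0 1%:M) i j.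
pose V := \mxrow_(j < 3) of3 0 0 (1%:M : 'M[R]_n) j.
have SE : S = \mxblock_(i < 3, j < 3)
    of3 (of3 0 w X^T) (of3 w^T 0 X'^T) (of3 X X' 0) i j.
  by rewrite /S Smx3E !wronskian_vertical !trmxK.
have SV : S *m V^T = \mxcol_(i < 3) of3 X^T X'^T 0 i.
  rewrite SE tr_mxrow mul_mxblock_mxrow; apply: eq_mxcol => i.
  by rewrite big_ord3 /= !trmx0 trmx1 !mulmx0 mulmx1 !add0r; case: i => [[|[|[|//]]] ?].
have aT : a^T = - (Xp *m X' *m T).
  by rewrite /a linearN /= !trmx_mul !trmxK T_sym mulmxA.
have aXT : a *m X^T + T *m X'^T = 0.
  rewrite -TX'H /H mulmxBr mulmx1 -XXp_sym trmx_mul !mulmxA mulNmx addrC //.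
have XaT : X *m a^T + X' *m T = 0.
  by apply: trmx_inj; rewrite linearD /= !trmx_mul trmxK T_sym aXT trmx0.
have GwT : G *m w *m T = 0 by apply: MT.
have TwG : T *m w^T *m G = 0.
  by apply: trmx_inj; rewrite trmx_mul3 trmxK G_sym T_sym GwT trmx0.
pose C := \mxcol_(i < 3) of3 X^T X'^T 0 i.
have KC : K *m C = 0.
  rewrite mul_mxblock_mxrow -[RHS](@mxcol0 _ _ (fun=> n)); apply: eq_mxcol => i.
  rewrite big_ord3; case: (ord3P i) => ->;
    by rewrite /of3 /= !mulmx0 ?mul0mx ?addr0 ?GXT // ?aXT.
have VC : V *m C = 0.
  by rewrite mul_mxrow_mxcol big_ord3 /of3 /= !mul0mx mulmx0 !addr0.
have rC : \rank C = (\rank X + \rank M)%N.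
  rewrite -rank_col eqmx_col 3!big_ord_recl big_ord0 /of3 /= genmx0 !addsmx0_id.
  by rewrite (adds_eqmx (genmxE _) (genmxE _)).
have KSK : K *m S *m K^T = \mxdiag_(i < 3) of3 (- 2 *: P) 0 0 i.
  rewrite /K SE tr_mxblock !mul_mxblock; apply: mxblock3P; rewrite /= !big_ord3 /of3 /=.
  all: rewrite ?(conform_mx_id, trmx0, trmx1, mulmx0, mul0mx, addr0, add0r).
  all: rewrite ?(mulmx1, mul1mx) //.
  all: rewrite ?T_sym ?G_sym //.
  rewrite [RHS]scaleNr scaler_nat mulr2n opprD; congr (_ + _).
    by rewrite aT mulmxN !mulmxA.
  by apply: trmx_inj; rewrite trmx_mul3 T_sym aT mulmxN [RHS]linearN /= P_sym !mulmxA.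
have kerK : (kermx C <= K)%MS.
  apply/rV_subP => v /sub_kermxP; pose x i := @submxrow R 3 (fun=> n) 1 v i.
  rewrite -[v]submxrowK mul_mxrow_mxcol big_ord3 /of3 /= mulmx0 addr0 => e.
  have x0E : x 0 *m X^T = - (x 1 *m X'^T) by apply/eqP; rewrite -addr_eq0; apply/eqP.
  have x1M : x 1 *m M^T = 0.
    have -> : M^T = - (X'^T *m U *m G) by rewrite ME linearN /= trmx_mul3 trmxK G_sym.
    rewrite mulmxN !mulmxA -2!mulNmx -x0E -(mulmxA (x 0)) XTU -!mulmxA XG.
    by rewrite !mulmx0.
  have x1T : x 1 *m T = x 1.
    rewrite -{1}T_sym /T /Tmx -/M linearB /= trmx1 trmx_mul mulmxBr mulmx1.
    by rewrite mulmxA x1M mul0mx subr0.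
  (* As [x 1] is fixed by [T], the splitting of [x 0] by the projectors [Xp *m X] and [G] reads
     [x 0 = x 1 *m a + x 0 *m G]. *)
  apply/submxP; exists (\mxrow_(i < 3) of3 (x 1) (x 0) (x ord_max) i).
  rewrite mul_mxrow_mxblock; apply/eq_mxrow => i; rewrite big_ord3.
  case: (ord3P i) => ->; rewrite /of3 /= !mulmx0 ?addr0 ?add0r ?mulmx1 //.
  rewrite /a mulmxN !mulmxA x1T -mulNmx -x0E -mulmxA -trmx_mul XpX_sym.
  by rewrite mulmxBr mulmx1 addrC subrK.
have cSV : c *: S *m V^T = c *: C by rewrite -scalemxAl SV.
have Ps : (- 2 *: P)^T = - 2 *: P by rewrite linearZ /= P_sym.
have cKSK : K *m (c *: S) *m K^T = \mxdiag_(i < 3) of3 (c *: (- 2 *: P)) 0 0 i.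
  rewrite -scalemxAr -scalemxAl KSK /mxdiag scale_mxblock.
  by apply: mxblock3P; rewrite /of3 /= ?conform_mx_id ?scaler0.
rewrite (i_minus_isotropic (Z := V) (K := K)).
- rewrite cSV cKSK (eqmx_scale _ c0) rC i_minus_mxdiag; last first.
    by move=> i; case: (ord3P i) => ->; rewrite /of3 /= ?trmx0 // linearZ /= Ps.
  rewrite big_ord3 /of3 /= i_minus0 !addn0 -addnA; congr (_ + (_ + _))%N.
  rewrite scalerA mulrC -mulrNN opprK -scalerA i_minus_scale ?ltr0n //.
  by rewrite linearZ /= P_sym.
- by rewrite linearZ /= tr_Smx.
- by rewrite -mulmxA cSV -scalemxAr VC scaler0.
- by rewrite -mulmxA cSV -scalemxAr KC scaler0.
- apply: submx_trans kerK; apply/sub_kermxP.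
  apply: (scalerI c0); rewrite scaler0 scalemxAr -cSV.
  exact: mulmx_ker.
Qed.
End Pair.

(** * Cancellation of the vertical frame in cyclic sums *)

Lemma i_minus_Smx_cyclic m (Y : 'I_m.+1 -> 'M[R]_(n + n, n)) c : c != 0 ->
  (forall k, frame (Y k)) ->
  i_minus (c *: Smx Y) =
  cyclic_sum (fun Y0 Y1 => \rank (Mmx Y0 Y1) + i_minus (- c *: Pmx Y0 Y1))%N Y.
Proof.
move=> c0 fY.
(* [None] indexes the vertical frame, so that one choice of [F] and [Q] serves all triples at
   once. *)
pose Yo (k : option 'I_m.+1) := if k is Some k' then Y k' else vertical_frame.
have fYo k : frame (Yo k) by case: k => [k|]; [apply: fY | apply: frame_vertical].
have [F [Q [Fu Qs wE]]] := frames_graph fYo.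
pose g i j := i_minus (- c *: (Q j - Q i)).
rewrite (@i_minus_Smx _ _ _ Y (F \o Some) (Q \o Some)) /=; first last.
- by move=> i j; rewrite -wE.
- by move=> k; apply: Qs.
- by move=> k; apply: Fu.
have triple i j : (\rank (usubmx (Y i)) + (\rank (Mmx (Y i) (Y j)) +
    i_minus (- c *: Pmx (Y i) (Y j))) =
    g (Some i) (Some j) + (g (Some j) None + g None (Some i)))%N.
  rewrite -i_minus_triple //.
  rewrite (@i_minus_Smx _ _ _ _ (of3 (F (Some i)) (F (Some j)) (F None))
     (of3 (Q (Some i)) (Q (Some j)) (Q None))).
  - by rewrite big_ord3.
  - by move=> k; case: (ord3P k) => ->; apply: Fu.
  - by move=> k; case: (ord3P k) => ->; apply: Qs.
  - move=> k l; case: (ord3P k) => ->; case: (ord3P l) => ->; rewrite /of3 /= -wE //.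
have g_vert i : (g (Some i) None + g None (Some i) = \rank (usubmx (Y i)))%N.
  have As : (- c *: (Q None - Q (Some i)))^T = - c *: (Q None - Q (Some i)).
    by rewrite linearZ linearB /= !Qs.
  rewrite /g -[X in (_ + i_minus (_ *: X))%N]opprB scalerN -mxrank_inertia //.
  rewrite (eqmx_scale _ (_ : - c != 0)) ?oppr_eq0 //.
  rewrite -[RHS]mxrank_tr -wronskian_vertical.
  rewrite -[vertical_frame]/(Yo None) -[Y i]/(Yo (Some i)) wE.
  rewrite mxrankMfree ?row_free_unit // (eqmxMfull _ _) //.
  by rewrite row_full_unit unitmx_tr.
rewrite /cyclic_sum; apply/eqP.
rewrite -(eqn_add2l (\sum_k \rank (usubmx (Y k)))) -[X in _ == X]big_split /=.
under [X in _ == X]eq_bigr do rewrite triple.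
(* The terms g(k+1, V) are shifted cyclically to g(k, V), which pair with g(V, k) to give the
   ranks. *)
rewrite !big_split /= [X in _ == (_ + (X + _))%N](_ : _ = \sum_k g (Some k) None)%N.
  rewrite addnC eqn_add2l -[X in _ == X]big_split; apply/eqP/eq_bigr => k _.
  exact/esym/g_vert.
by rewrite [RHS](reindex_inj (bij_inj (ordS_bij _))).
Qed.

(** The scalar 1 gives the dual index and the negative inertia; -1 gives the other pair. *)
Lemma cyclic_sums_inertia m (Y : 'I_m.+1 -> 'M[R]_(n + n, n)) :
  (forall k, frame (Y k)) ->
  [/\ mu_c_plus Y = i_minus (Smx Y), mu_c_minus Y = i_plus (Smx Y) &
      i_plus (Smx Y) = ind (- Smx Y)].
Proof.
move=> fY; have Ss := tr_Smx Y.
have cN0 : (-1 : R) != 0 by rewrite oppr_eq0 oner_eq0.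
split; last exact: i_plusE.
  rewrite -[Smx Y]scale1r (i_minus_Smx_cyclic (oner_neq0 R) fY).
  by apply: eq_bigr => k _; rewrite scaleN1r.
rewrite (i_plusE Ss) -scaleN1r (i_minus_Smx_cyclic cN0 fY).
by apply: eq_bigr => k _; rewrite opprK scale1r.
Qed.
End Triple.

Theorem theorem1p2 (R : realType) (m n : nat) (hm : (2 <= m)%N)
    (Y : 'I_m -> 'M[R]_(n + n, n)) (hY : forall k : 'I_m, frame (Y k)) :
  (mu_c_plus Y = i_minus (Smx Y) /\ i_minus (Smx Y) = ind (Smx Y)) /\
  (mu_c_minus Y = i_plus (Smx Y) /\ i_plus (Smx Y) = ind (- Smx Y)%R).
Proof.
case: m hm Y hY => [//|m] _ Y hY.
by have [muP muM ip] := cyclic_sums_inertia hY.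
Qed.
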